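(* Let $$A_1=\begin{pmatrix}a_1&0\\ a_2&a_4\end{pmatrix},\quad A_2=\begin{pmatrix}\gamma_1&0\\ \gamma_2&a_4\end{pmatrix},\quad B=\begin{pmatrix}b_1\\ b_2\end{pmatrix}$$ be real matrices defining an unobservable planar bimodal linear system, and set $\Delta_1=b_1a_2+(a_4-a_1)b_2$ and $\Delta_2=b_1\gamma_2+(a_4-\gamma_1)b_2$. Then the bimodal linear system defined by $(A_1,A_2,B)$ is controllable if and only if $$b_1\neq 0\quad\text{and}\quad \Delta_1\Delta_2>0.$$
   Context: A planar bimodal linear system is given by a triple $(A_1,A_2,B)\in M_2(\mathbb{R})\times M_2(\mathbb{R})\times M_{2\times 1}(\mathbb{R})$ such that $A_1$ and $A_2$ have the same second column, together with $C=(1\;\,0)$. It is observable if $\operatorname{rank}\begin{pmatrix}C\\ CA_i\end{pmatrix}=2$ for $i=1,2$, and unobservable otherwise; unobservability means exactly that the $(1,2)$ entry common to $A_1$ and $A_2$ is zero, so the matrices in the claim are the general form of an unobservable planar system. The system with scalar input $u$ is $$\dot x(t)=A_1x(t)+Bu(t)\ \text{ if } Cx(t)\le 0,\qquad \dot x(t)=A_2x(t)+Bu(t)\ \text{ if } Cx(t)\ge 0,$$ which is well defined since $A_1x=A_2x$ whenever $Cx=0$. It is controllable if for every pair of states $x_0,x_f\in\mathbb{R}^2$ there exist a time $T_f>0$ and a locally integrable input $u:[0,T_f]\to\mathbb{R}$ such that the (absolutely continuous) solution with $x(0)=x_0$ satisfies $x(T_f)=x_f$. *)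

(* Defs.v *)
From HB Require Import structures.
From mathcomp Require Export all_boot all_order all_algebra.
From mathcomp Require Export all_classical all_reals all_analysis.
Export Order.TTheory GRing.Theory Num.Theory.
Export numFieldNormedType.Exports.

Set Implicit Arguments.
Unset Strict Implicit.
Unset Printing Implicit Defensive.

Local Open Scope classical_set_scope.
Local Open Scope ring_scope.

(* The library's [locally_integrable D f] additionally requires [D] to be open,
   which excludes [D = `[0, T]]. *)
Definition locally_integrable_on (R : realType) (D : set R) (f : R -> R) : Prop :=
  measurable_fun D f /\
  forall K : set R, K `<=` D -> compact K ->
    (\int[@lebesgue_measure R]_(t in K) `|f t|%:E < +oo)%E.

Definition absolutely_continuous_on (R : realType) (V : normedModType R)
    (a b : R) (f : R -> V) : Prop :=
  forall e : R, 0 < e -> exists2 d : R, 0 < d &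
    forall (n : nat) (u v : 'I_n -> R),
      (forall i, [/\ a <= u i, u i < v i & v i <= b]) ->
      trivIset setT (fun i => `]u i, v i[%classic : set R) ->
      \sum_(i < n) (v i - u i) < d ->
      \sum_(i < n) `|f (v i) - f (u i)| < e.

Definition mat22 (R : realType) (a b c d : R) : 'M[R]_2 :=
  \matrix_(i, j) nth 0 (nth [::] [:: [:: a; b]; [:: c; d]] i) j.

Definition vec2 (R : realType) (a b : R) : 'cV[R]_2 :=
  \col_i nth 0 [:: a; b] i.

(* Indices in ['I_2] start at 0, so [col 1] is the second column. *)
Record bimodal_system (R : realType) := BimodalSystem {
  bimodal_A1 : 'M[R]_2;
  bimodal_A2 : 'M[R]_2;
  bimodal_B : 'cV[R]_2;
  bimodal_cont : col 1 bimodal_A1 = col 1 bimodal_A2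
}.

Definition bimodal_C (R : realType) : 'rV[R]_2 := \row_j nth 0 [:: 1; 0] j.

Definition observable (R : realType) (S : bimodal_system R) : bool :=
  let C := bimodal_C R in
  (\rank (col_mx C (C *m bimodal_A1 S)) == 2%N) &&
  (\rank (col_mx C (C *m bimodal_A2 S)) == 2%N).

Definition unobservable (R : realType) (S : bimodal_system R) : bool :=
  ~~ observable S.

(* Caratheodory solutions on [0, T]. The values of [u] and [x] outside [0, T]
   are irrelevant: they can only affect the derivative at 0 and T, which form
   a null set. *)
Definition is_solution (R : realType) (S : bimodal_system R) (T : R)
    (u : R -> R) (x : R -> 'cV[R]_2) : Prop :=
  absolutely_continuous_on 0 T x /\
  {ae @lebesgue_measure R, forall t, 0 <= t <= T ->
    ((bimodal_C R *m x t) 0 0 <= 0 ->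
       is_derive t 1 x (bimodal_A1 S *m x t + u t *: bimodal_B S)) /\
    (0 <= (bimodal_C R *m x t) 0 0 ->
       is_derive t 1 x (bimodal_A2 S *m x t + u t *: bimodal_B S))}.

Definition controllable (R : realType) (S : bimodal_system R) : Prop :=
  forall x0 xf : 'cV[R]_2,
    exists (T : R) (u : R -> R) (x : R -> 'cV[R]_2),
      [/\ 0 < T, locally_integrable_on `[0, T]%classic u, is_solution S T u x,
          x 0 = x0 & x T = xf].

(* Main.v *)
Require Import Defs.
From mathcomp Require Import measurable_realfun ring lra.

(** If [b1 <> 0], then [w = b1 x2 - b2 x1] satisfies, whatever the input,
    [w' = a4 w + Delta_i x1], with [i = 1] for [x1 <= 0] and [i = 2] for
    [x1 >= 0]. When [Delta1] and [Delta2] have the same sign, [x1] can be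
    recovered from [w' - a4 w], so every C^1 function [w] with the right values
    and derivatives at the end points, for instance a cubic polynomial, yields a
    trajectory. Otherwise [w' - a4 w] has constant sign, so that starting from
    the origin [w] cannot change sign in one of the two directions. If
    [b1 = 0], then [|x1'| <= M |x1|] and [x1] cannot leave [0].

    The last two points rest on the fact that an absolutely continuous function
    whose derivative is nonpositive almost everywhere is nonincreasing. *)

Set Implicit Arguments.
Unset Strict Implicit.
Unset Printing Implicit Defensive.

Local Open Scope classical_set_scope.
Local Open Scope ring_scope.

(** * Real induction and the monotonicity criterion for absolutely continuous functions *)

(** The supremum of the points satisfying [P] cannot lie below [b]. As [s] and [t] straddle [c], one
    step both reaches the supremum and goes beyond it. *)
Lemma continuous_induction (R : realType) (a b : R) (P : R -> Prop) :
  a <= b -> P a ->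
  (forall c, a <= c <= b -> exists2 d, 0 < d &
    forall s t, a <= s -> c - d < s -> s <= c -> c <= t -> t < c + d ->
      t <= b -> P s -> P t) ->
  P b.
Proof.
move=> ab Pa step.
pose S := [set x | a <= x <= b /\ P x].
have Sa : S a by rewrite /S /= lexx ab.
have ubS : ubound S b by move=> x [] /andP[].
have supS : has_sup S by split; [exists a | exists b].
have cab : a <= sup S <= b.
  by rewrite (ub_le_sup supS.2 Sa) (ge_sup supS.1 ubS).
have [d d0 Pd] := step _ cab.
move/andP: cab => [ac cb].
have [s [/andP[as_ sb] Ps] ds] := sup_adherent d0 supS.
have sc : s <= sup S by exact: (ub_le_sup supS.2 (conj (introT andP (conj as_ sb)) Ps)).
have [bc|bc] := ltP b (sup S + d).
  by apply: (Pd s b) => //; lra.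
have : S (sup S + d / 2).
  by split; [lra | apply: (Pd s) => //; lra].
move=> /(ub_le_sup supS.2); lra.
Qed.

Section absolute_continuity.
Context {R : realType}.
Let mu := @lebesgue_measure R.

(** The increment is split at [c], and each half is controlled by a difference quotient at [c]. The
    straddling form is the one that [continuous_induction] asks for. *)
Lemma derive_le0_locally (f : R -> R) (c l e : R) :
  is_derive c 1 f l -> l <= 0 -> 0 < e ->
  exists2 d, 0 < d & forall s t, c - d < s -> s <= c -> c <= t -> t < c + d ->
    f t - f s <= e * (t - s).
Proof.
move=> [df dfl] l0 e0.
move: df => /cvg_ex[/= l' cl'].
have ll' : l' = l by rewrite -dfl; apply/esym/cvg_lim.
rewrite {l'}ll' in cl'.
move/cvgrPdist_le : cl' => /(_ _ e0)[/= d d0 Hd].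
exists d => // s t ds sc ct td.
have Hr r : `|r - c| < d -> r != c -> `|l - (r - c)^-1 * (f r - f c)| <= e.
  move=> rd rc.
  have := Hd (r - c); rewrite /= sub0r normrN subr_eq0 => /(_ rd rc).
  by rewrite /GRing.scale /= mulr1 subrK.
have Ht : f t - f c <= e * (t - c).
  have [->|tc] := eqVneq t c; first by rewrite !subrr mulr0.
  have tc0 : 0 < t - c by rewrite subr_gt0 lt_neqAle eq_sym tc.
  have := Hr t _ tc; rewrite gtr0_norm// => /(_ _)/wrap[]; first lra.
  rewrite ler_norml => /andP[h _].
  rewrite -ler_pdivrMr// mulrC; lra.
have Hs : f c - f s <= e * (c - s).
  have [->|tc] := eqVneq s c; first by rewrite !subrr mulr0.
  have tc0 : 0 < c - s by rewrite subr_gt0 lt_neqAle tc.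
  have := Hr s _ tc; rewrite distrC gtr0_norm// => /(_ _)/wrap[]; first lra.
  rewrite ler_norml => /andP[h _].
  rewrite -ler_pdivrMr// mulrC.
  have -> : (c - s)^-1 * (f c - f s) = (s - c)^-1 * (f s - f c).
    by rewrite -(opprB s c) -(opprB (f s)) invrN mulrNN.
  lra.
have -> : f t - f s = (f t - f c) + (f c - f s) by ring.
have -> : e * (t - s) = e * (t - c) + e * (c - s) by ring.
exact: lerD.
Qed.

(* Outside [U] the derivative keeps the increase of [f] below [e] per unit of
   time; inside [U] the increase is absorbed by adding an interval to the family. *)
Lemma increase_le_sum_over_open (a b e : R) (f : R -> R) (U : set R) :
  a <= b -> 0 < e -> open U ->
  (forall t, a <= t <= b -> ~ U t ->
     exists2 l, l <= 0 & is_derive t 1 f l) ->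
  exists (n : nat) (u v : 'I_n -> R),
    [/\ forall i, [/\ a <= u i, u i < v i & v i <= b],
        trivIset setT (fun i => `]u i, v i[%classic : set R),
        ((\sum_(i < n) (v i - u i))%:E <= mu U)%E &
        f b - f a <= e * (b - a) + \sum_(i < n) `|f (v i) - f (u i)|].
Proof.
move=> ab e0 oU df.
have mU : measurable U by exact: open_measurable.
(* Only the part of [U] up to [t] is counted, so that the measures add up when an interval is
   appended. *)
pose P t := exists (n : nat) (u v : 'I_n -> R),
    [/\ forall i, [/\ a <= u i, u i < v i & v i <= t],
        trivIset setT (fun i => `]u i, v i[%classic : set R),
        ((\sum_(i < n) (v i - u i))%:E <= mu (U `&` `]a, t]))%E &
        f t - f a <= e * (t - a) + \sum_(i < n) `|f (v i) - f (u i)|].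
suff [n [u [v [uv tI sU fab]]]] : P b.
  exists n, u, v; split=> //; apply: le_trans sU _.
  by apply: le_measure; rewrite ?inE//; exact: measurableI.
apply: (@continuous_induction R a b P ab).
  exists 0%N, (fun=> 0), (fun=> 0); split.
  - by case.
  - by move=> [].
  - by rewrite big_ord0 measure_ge0.
  - by rewrite big_ord0 !subrr mulr0 addr0.
move=> c cab.
have [Uc|nUc] := pselect (U c); last first.
  have [l l0 dl] := df c cab nUc.
  have [d d0 Hd] := derive_le0_locally dl l0 e0.
  exists d => // s t as_ ds sc ct td tb [n [u [v [uv tI sU fas]]]].
  exists n, u, v; split=> //.
  - by move=> i; have [? ? ?] := uv i; split=> //; lra.
  - apply: le_trans sU _; apply: le_measure; rewrite ?inE//; try exact: measurableI.
    apply: setIS; apply: subset_itvl; rewrite bnd_simp; lra.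
  - have := Hd s t ds sc ct td.
    have -> : e * (t - a) = e * (t - s) + e * (s - a) by ring.
    lra.
have [d /= d0 dU] := open_subball oU Uc.
(* [dU] covers radii strictly below [d]; with [d / 2] the whole of []s, t]] lies in [U]. *)
exists (d / 2); first lra.
move=> s t as_ ds sc ct td tb [n [u [v [uv tI sU fas]]]].
have [st|st] := eqVneq s t.
  by rewrite -st; exists n, u, v.
have {}st : s < t by lra.
(* [unlift ord_max i] is [None] exactly at the last index, which receives the new interval []s,
   t[]. *)
exists n.+1, (fun i => oapp u s (unlift ord_max i)),
  (fun i => oapp v t (unlift ord_max i)); split.
- by move=> i; case: unliftP => [j|] _ /=; [have [? ? ?] := uv j|]; split=> //; lra.
- move=> i j _ _ /=.
  case: unliftP => [i'|] -> /=; case: unliftP => [j'|] -> //=.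
  + by move=> /tI -> //.
  + move=> [z [] /=]; rewrite !in_itv /=; have [? ? ?] := uv i'; move=> ? ?; exfalso; lra.
  + move=> [z [] /=]; rewrite !in_itv /=; have [? ? ?] := uv j'; move=> ? ?; exfalso; lra.
- rewrite big_ord_recr /= unlift_none /=.
  under eq_bigr => i _.
    have -> : widen_ord (leqnSn n) i = lift ord_max i.
      by apply: val_inj; rewrite /= /bump leqNgt ltn_ord.
    rewrite liftK /=; over.
  rewrite EFinD.
  have -> : U `&` `]a, t] = (U `&` `]a, s]) `|` `]s, t].
    apply/seteqP; split=> [z [Uz]|z [[Uz]|]] /=; rewrite ?in_itv /=.
    + move=> zat; case: (leP z s) => zs; [left; split=> //= | right];
        rewrite ?in_itv /=; lra.
    + by move=> zas; split=> //; rewrite ?in_itv /=; lra.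
    + move=> zst; split; last by rewrite ?in_itv /=; lra.
      apply: (dU (d / 2)); rewrite /= ?sub0r ?normrN ?gtr0_norm; try lra.
      rewrite /ball /= ltr_norml; lra.
  rewrite /mu measureU//; first last.
    apply/seteqP; split=> // z [[_]] /=; rewrite !in_itv /=; lra.
    exact: measurableI.
  apply: leeD => //.
  have := @lebesgue_measure_itv R `]s, t]; rewrite /= lte_fin st => h.
  by rewrite EFinB -h.
- rewrite big_ord_recr /= unlift_none /=.
  under eq_bigr => i _.
    have -> : widen_ord (leqnSn n) i = lift ord_max i.
      by apply: val_inj; rewrite /= /bump leqNgt ltn_ord.
    rewrite liftK /=; over.
  have h1 := ler_norm (f t - f s).
  have h2 : e * (s - a) <= e * (t - a) by rewrite ler_pM2l//; lra.
  lra.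
Qed.

(** The exceptional null set is enclosed in an open set so small that absolute continuity bounds the
    increase collected there. *)
Lemma absolutely_continuous_nonincreasing (a b : R) (f : R -> R) :
  a <= b -> absolutely_continuous_on a b f ->
  {ae mu, forall t, a <= t <= b -> exists2 l, l <= 0 & is_derive t 1 f l} ->
  f b <= f a.
Proof.
move=> ab acf [N [mN N0 subN]].
apply/ler_addgt0Pr => e e0.
(* The slope outside [U] costs [b - a] times this amount and the intervals cost it once more, [e] in
   total. *)
have e'0 : 0 < e / (b - a + 1) by apply: divr_gt0 => //; lra.
have [d d0 Hd] := acf _ e'0.
have Noo : (mu N < +oo)%E by rewrite N0.
have [U [oU NU]] := @lebesgue_regularity_outer R N d mN Noo d0.
have mU : measurable U by exact: open_measurable.
(* Regularity bounds the measure of [U] minus [N]; since [N] is null, [U] has the same measure. *)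
move=> UNd; have {UNd}Ud : (mu U < d%:E)%E.
  apply: le_lt_trans UNd.
  have UN0 : mu (U `&` N) = 0%E.
    apply/eqP; rewrite eq_le measure_ge0 andbT -N0.
    by apply: le_measure; rewrite ?inE//; exact: measurableI.
  rewrite -[leRHS]adde0 -UN0.
  rewrite le_eqVlt; apply/orP; left; apply/eqP.
  exact: (measureDI lebesgue_measure mU mN).
have dU t : a <= t <= b -> ~ U t -> exists2 l, l <= 0 & is_derive t 1 f l.
  move=> tab Ut; apply: contrapT => nd; apply/Ut/NU/subN => /= h.
  exact: nd (h tab).
have [n [u [v [uv tI sU fab]]]] := increase_le_sum_over_open ab e'0 oU dU.
have := Hd n u v uv tI.
rewrite -lte_fin => /(_ (le_lt_trans sU Ud)) fe.
have : e / (b - a + 1) * (b - a) + e / (b - a + 1) = e.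
  by field; apply/eqP; lra.
lra.
Qed.
End absolute_continuity.

(** * Closure properties of absolute continuity and a Gronwall inequality *)

Section absolute_continuity_closure.
Context {R : realType}.

Lemma absolutely_continuous_id (a b : R) :
  absolutely_continuous_on a b (fun t : R => t).
Proof.
move=> e e0; exists e => // n u v uv _ h.
rewrite (eq_bigr (fun i => v i - u i)) => [//|i _].
by have [_ uv_i _] := uv i; rewrite gtr0_norm// subr_gt0.
Qed.

(** Common source of the closure properties: sums, products, coordinates and Lipschitz images all
    have increments dominated in this way. *)
Lemma absolutely_continuous_dominated (V W X : normedModType R) (a b C : R)
    (f : R -> V) (g : R -> W) (h : R -> X) :
  (forall s t, a <= s -> s < t -> t <= b ->
     `|h t - h s| <= C * (`|f t - f s| + `|g t - g s|)) ->
  absolutely_continuous_on a b f -> absolutely_continuous_on a b g ->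
  absolutely_continuous_on a b h.
Proof.
move=> hfg acf acg e e0.
have C0 : 0 < `|C| + 1 by rewrite ltr_wpDl.
have e'0 : 0 < e / (`|C| + 1) / 2 by rewrite !divr_gt0.
have [d1 d10 Hd1] := acf _ e'0.
have [d2 d20 Hd2] := acg _ e'0.
exists (Order.min d1 d2); first by rewrite lt_min d10.
move=> n u v uv tI; rewrite lt_min => /andP[h1 h2].
have {}Hd1 := Hd1 n u v uv tI h1.
have {}Hd2 := Hd2 n u v uv tI h2.
apply: (@le_lt_trans _ _ ((`|C| + 1) *
   (\sum_(i < n) `|f (v i) - f (u i)| + \sum_(i < n) `|g (v i) - g (u i)|))).
  rewrite -big_split /= mulr_sumr; apply: ler_sum => i _.
  have [ui uvi vi] := uv i.
  apply: le_trans (hfg _ _ ui uvi vi) _.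
  apply: ler_wpM2r; first by rewrite addr_ge0.
  by rewrite (le_trans (ler_norm C))// lerDl.
by rewrite mulrC -ltr_pdivlMr//; lra.
Qed.

Lemma absolutely_continuous_lipschitz (V : normedModType R) (a b C : R) (f : R -> V) :
  (forall s t, a <= s -> s < t -> t <= b -> `|f t - f s| <= C * (t - s)) ->
  absolutely_continuous_on a b f.
Proof.
move=> fC; have acid := @absolutely_continuous_id a b.
(* The identity serves as both dominating functions, hence the half. *)
apply: (absolutely_continuous_dominated (C := C / 2) _ acid acid) => s t as_ st tb.
apply: le_trans (fC _ _ as_ st tb) _.
by rewrite gtr0_norm ?subr_gt0//; lra.
Qed.

(** Over a length below the [d] attached to [1] the function moves by less than [1], so each
    induction step raises the bound by [1]. *)
Lemma absolutely_continuous_bounded (V : normedModType R) (a b : R) (f : R -> V) :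
  a <= b -> absolutely_continuous_on a b f ->
  exists M, forall t, a <= t -> t <= b -> `|f t| <= M.
Proof.
move=> ab acf.
have [d d0 Hd] := acf 1 ltr01.
have near_bound s t : a <= s -> s < t -> t <= b -> t - s < d -> `|f t - f s| < 1.
  move=> as_ st tb std.
  have := Hd 1%N (fun=> s) (fun=> t); rewrite !big_ord1; apply=> //.
  by move=> i j _ _ _; rewrite !ord1.
apply: (@continuous_induction R a b
  (fun c => exists M, forall t, a <= t -> t <= c -> `|f t| <= M) ab).
  by exists `|f a| => t h1 h2; have -> : t = a by lra.
move=> c cab; exists (d / 2); first lra.
move=> s t as_ ds sc ct td tb [M HM]; exists (M + 1) => r ar rt.
have [rs|sr] := leP r s; first by have := HM r ar rs; lra.
have h1 := HM s as_ (lexx s).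
have h2 : `|f r - f s| < 1 by apply: near_bound => //; lra.
have := ler_normD (f r - f s) (f s); rewrite subrK; lra.
Qed.

Lemma absolutely_continuousM (a b : R) (f g : R -> R) :
  a <= b -> absolutely_continuous_on a b f -> absolutely_continuous_on a b g ->
  absolutely_continuous_on a b (fun t => f t * g t).
Proof.
move=> ab acf acg.
have [M HM] := absolutely_continuous_bounded ab acf.
have [N HN] := absolutely_continuous_bounded ab acg.
have M0 := le_trans (normr_ge0 _) (HM a (lexx a) ab).
have N0 := le_trans (normr_ge0 _) (HN a (lexx a) ab).
apply: (absolutely_continuous_dominated (C := M + N) _ acf acg) => s t as_ st tb.
have -> : f t * g t - f s * g s = f t * (g t - g s) + (f t - f s) * g s by ring.
apply: le_trans (ler_normD _ _) _; rewrite !normrM.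
have h1 : `|f t| * `|g t - g s| <= M * `|g t - g s|.
  by apply: ler_wpM2r => //; apply: HM; lra.
have h2 : `|f t - f s| * `|g s| <= `|f t - f s| * N.
  by apply: ler_wpM2l => //; apply: HN; lra.
have h3 : 0 <= M * `|f t - f s| by rewrite mulr_ge0.
have h4 : 0 <= N * `|g t - g s| by rewrite mulr_ge0.
lra.
Qed.

(** The derivative is bounded on the segment, so the mean value theorem gives a Lipschitz bound. *)
Lemma absolutely_continuous_C1 (a b : R) (f df : R -> R) :
  (forall t : R, is_derive t 1 f (df t)) -> continuous df ->
  absolutely_continuous_on a b f.
Proof.
move=> fdf cdf.
have [M HM] : exists M, forall t, a <= t -> t <= b -> `|df t| <= M.
  have [ab|ba] := leP a b; last by exists 0 => t ? ?; exfalso; lra.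
  have [|c _ Hc] := @EVT_max R (fun t => `|df t|) a b ab.
    by apply: continuous_subspaceT => t; apply: cvg_norm; exact: cdf.
  exists `|df c| => t at_ tb; apply: Hc; rewrite in_itv /=; lra.
apply: (@absolutely_continuous_lipschitz _ a b M) => s t as_ st tb.
have [|c cst ->] := MVT_segment (ltW st) (fun x _ => fdf x).
  apply: continuous_subspaceT => x.
  by apply: differentiable_continuous; apply/derivable1_diffP; have [] := fdf x.
rewrite normrM (gtr0_norm (x := t - s)) ?subr_gt0//.
apply: ler_wpM2r; first lra.
move: cst; rewrite in_itv /= => /andP[? ?]; apply: HM; lra.
Qed.

(** With the integrating factor [E t = expR (- k * t)], the product [y * E] has derivative
    [E * (l - k * y) <= 0]. *)
Lemma gronwall_le0 (a b k : R) (y : R -> R) :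
  a <= b -> absolutely_continuous_on a b y ->
  {ae @lebesgue_measure R, forall t, a <= t <= b ->
     exists2 l, l <= k * y t & is_derive t 1 y l} ->
  y a <= 0 -> y b <= 0.
Proof.
move=> ab acy dy ya.
pose E t := expR (- k * t).
have dE (t : R) : is_derive t 1 E (- k * E t).
  rewrite /E; apply: is_derive_eq; rewrite /GRing.scale /=; ring.
have cE : continuous E.
  move=> t; apply: differentiable_continuous.
  by apply/derivable1_diffP; have [] := dE t.
have acE : absolutely_continuous_on a b E.
  apply: absolutely_continuous_C1 dE _ => t.
  by apply: cvgM; [exact: cvg_cst | exact: cE].
have : y b * E b <= y a * E a.
  apply: (@absolutely_continuous_nonincreasing R a b (fun t => y t * E t) ab).
    exact: absolutely_continuousM.
  apply: negligibleS dy => t; apply: contra_not => dyt tab; have [l ly dl] := dyt tab.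
  have dEt := dE t.
  exists (y t * (- k * E t) + E t * l).
    rewrite (_ : _ + _ = E t * (l - k * y t)); last by ring.
    by rewrite pmulr_rle0 ?subr_le0// expR_gt0.
  exact: is_deriveM.
have Eb : 0 < E b by exact: expR_gt0.
have Ea : 0 < E a by exact: expR_gt0.
move=> h; rewrite -(pmulr_lle0 _ Eb); apply: le_trans h _.
by rewrite pmulr_lle0.
Qed.

End absolute_continuity_closure.

(** * Derivatives of matrices, roots of polynomials, local integrability *)

Lemma is_derive_mxP (R : realType) (V : normedModType R) (m n : nat)
    (M : V -> 'M[R]_(m, n)) (t v : V) (L : 'M[R]_(m, n)) :
  is_derive t v M L <-> forall i j, is_derive t v (fun s => M s i j) (L i j).
Proof.
split=> [[dM <-] i j|dM].
  split; first exact: (derivable_mxP M t v).1.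
  by rewrite derive_mx// mxE.
have dM' : derivable M t v.
  by apply/derivable_mxP => i j; have [] := dM i j.
split=> //; rewrite derive_mx//; apply/matrixP => i j; rewrite mxE.
by have [_ ->] := dM i j.
Qed.

(** Each root splits off a linear factor. This later discards, as a null set, the times at which the
    trajectory may switch modes. *)
Lemma finite_roots (R : idomainType) (p : {poly R}) :
  p != 0 -> finite_set [set x | root p x].
Proof.
elim: {p}(size p) {-2}p (leqnn (size p)) => [|n IHn] p.
  by rewrite leqn0 size_poly_eq0 => ->.
move=> sp p0; have [[a /= pa]|npa] := pselect (exists a, root p a); last first.
  by rewrite (_ : [set x | _] = set0)// -subset0 => x px; apply: npa; exists x.
have [q pq] := factor_theorem _ _ pa.
have q0 : q != 0 by apply: contraNneq p0 => q0; rewrite pq q0 mul0r.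
have qn : (size q <= n)%N.
  by move: sp; rewrite pq size_Mmonic ?monicXsubC// size_XsubC addn2.
apply: (@sub_finite_set _ _ ([set a] `|` [set x | root q x])).
  by move=> x /=; rewrite pq rootM root_XsubC => /orP[|/eqP]; [right|left].
by rewrite finite_setU; split; [exact: finite_set1 | exact: IHn].
Qed.

Lemma locally_integrable_on_dominated (R : realType) (D : set R) (u g : R -> R) :
  measurable_fun setT u -> continuous g ->
  (forall t, `|u t| <= g t) -> locally_integrable_on D u.
Proof.
move=> mu cg ug; split; first exact: (measurable_funTS mu).
move=> K KD cK.
have mK : measurable K by exact: compact_measurable.
have /integrableP[mg gK] :
    (@lebesgue_measure R).-integrable K (EFin \o g).
  by apply: continuous_compact_integrable => //; exact: continuous_subspaceT.
apply: le_lt_trans gK; apply: ge0_le_integral => //=.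
- apply/measurable_EFinP; apply: measurableT_comp => //.
  exact: (measurable_funTS mu).
- by move/measurable_EFinP : mg => mg; apply/measurable_EFinP; exact: measurableT_comp.
- by move=> t _; rewrite lee_fin (le_trans (ug t))// ler_norm.
Qed.

(** * The bimodal system in coordinates *)

Lemma bimodal_CE (R : realType) (x : 'cV[R]_2) : (bimodal_C R *m x) 0 0 = x 0 0.
Proof.
rewrite mxE !big_ord_recl big_ord0 !mxE /= mul1r mul0r !addr0.
by congr (x _ _); exact: val_inj.
Qed.

Lemma vec2P (R : realType) (x : 'cV[R]_2) a b :
  x = vec2 a b <-> x 0 0 = a /\ x 1 0 = b.
Proof.
split=> [->|[xa xb]]; first by rewrite !mxE.
apply/colP => i; rewrite !mxE.
have [->|->] : i = 0 \/ i = 1; last 2 first.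
- by rewrite xa.
- by rewrite xb.
by case: i => [[|[|]]]// ?; [left|right]; exact: val_inj.
Qed.

Lemma is_derive_affine (R : realType) (x : R -> 'cV[R]_2) (t w p q r b1 b2 : R) :
  is_derive t 1 x (mat22 p 0 q r *m x t + w *: vec2 b1 b2) <->
  is_derive t 1 (fun s => x s 0 0) (p * x t 0 0 + w * b1) /\
  is_derive t 1 (fun s => x s 1 0) (q * x t 0 0 + r * x t 1 0 + w * b2).
Proof.
have -> : mat22 p 0 q r *m x t + w *: vec2 b1 b2 =
    vec2 (p * x t 0 0 + w * b1) (q * x t 0 0 + r * x t 1 0 + w * b2).
  apply/vec2P; rewrite !mxE !big_ord_recl !big_ord0 !mxE /= !addr0.
  have -> : lift ord0 ord0 = 1 :> 'I_2 by exact: val_inj.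
  by rewrite mul0r addr0.
rewrite is_derive_mxP; split=> [h|[h0 h1] i j].
  by have := h 0 0; have := h 1 0; rewrite !mxE.
rewrite (ord1 j) mxE.
case: i => [[|[|]]]// ?.
- by rewrite (_ : Ordinal _ = 0)//; exact: val_inj.
- by rewrite (_ : Ordinal _ = 1)//; exact: val_inj.
Qed.

Lemma absolutely_continuous_coord (R : realType) (a b : R) (x : R -> 'cV[R]_2) i :
  absolutely_continuous_on a b x ->
  absolutely_continuous_on a b (fun t => x t i 0).
Proof.
move=> acx; apply: (absolutely_continuous_dominated (C := 1) _ acx acx).
move=> s t _ _ _; rewrite mul1r ler_wpDr//.
have -> : x t i 0 - x s i 0 = (x t - x s) i 0 by rewrite !mxE.
rewrite [leRHS]/Num.Def.normr /= mx_normrE.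
exact: (le_bigmax _ (fun ij => `|(x t - x s) ij.1 ij.2|) (i, 0)).
Qed.

(** The pair [p], [q] is the first column of an active matrix, so that one computation serves both
    modes. *)
Lemma solutionP (R : realType) (a1 a2 a4 g1 g2 b1 b2 : R)
    (S : bimodal_system R) (T : R) (u : R -> R) (x : R -> 'cV[R]_2) :
  bimodal_A1 S = mat22 a1 0 a2 a4 -> bimodal_A2 S = mat22 g1 0 g2 a4 ->
  bimodal_B S = vec2 b1 b2 -> is_solution S T u x ->
  [/\ absolutely_continuous_on 0 T (fun t => x t 0 0),
      absolutely_continuous_on 0 T (fun t => x t 1 0) &
      {ae @lebesgue_measure R, forall t, 0 <= t <= T ->
        exists p q, [/\
          is_derive t 1 (fun s => x s 0 0) (p * x t 0 0 + u t * b1),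
          is_derive t 1 (fun s => x s 1 0)
            (q * x t 0 0 + a4 * x t 1 0 + u t * b2) &
          x t 0 0 <= 0 /\ p = a1 /\ q = a2 \/
          0 <= x t 0 0 /\ p = g1 /\ q = g2]}].
Proof.
move=> A1 A2 AB [acx dx]; split; try exact: absolutely_continuous_coord.
apply: negligibleS dx => t; apply: contra_not => dxt tT.
have := dxt tT; rewrite bimodal_CE A1 A2 AB => -[d1 d2].
have [x0|x0] := leP (x t 0 0) 0.
  by have [? ?] := (is_derive_affine _ _ _ _ _ _ _ _).1 (d1 x0);
    exists a1, a2; split=> //; left.
have [? ?] := (is_derive_affine _ _ _ _ _ _ _ _).1 (d2 (ltW x0)).
exists g1, g2; split=> //.
by right; split=> //; exact: ltW.
Qed.

(** * Necessity of the two conditions *)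

(** If [b1 = 0], the square of the first coordinate satisfies a linear differential inequality, so
    Gronwall keeps it at [0] and [(1, 0)] is out of reach from the origin. *)
Lemma controllable_b1_neq0 (R : realType) (a1 a2 a4 g1 g2 b1 b2 : R)
    (S : bimodal_system R) :
  bimodal_A1 S = mat22 a1 0 a2 a4 -> bimodal_A2 S = mat22 g1 0 g2 a4 ->
  bimodal_B S = vec2 b1 b2 -> controllable S -> b1 != 0.
Proof.
move=> A1 A2 AB ctr; apply/eqP => b10.
have [T [u [x [T0 _ sx x0 xT]]]] := ctr (vec2 0 0) (vec2 1 0).
have [ac1 _ dx] := solutionP A1 A2 AB sx.
have [x00 _] := (vec2P _ _ _).1 x0; have [xT0 _] := (vec2P _ _ _).1 xT.
suff : x T 0 0 * x T 0 0 <= 0 by rewrite xT0; lra.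
apply: (@gronwall_le0 R 0 T (2 * (`|a1| + `|g1|)) (fun t => x t 0 0 * x t 0 0) (ltW T0)).
- exact: (absolutely_continuousM (ltW T0) ac1 ac1).
- apply: negligibleS dx => t; apply: contra_not => dxt tT.
  have [p [q [dx1 _ hp]]] := dxt tT.
  exists (x t 0 0 * (p * x t 0 0 + u t * b1)
          + x t 0 0 * (p * x t 0 0 + u t * b1)); last first.
    exact: is_deriveM.
  rewrite b10 mulr0 addr0.
  have h : p <= `|a1| + `|g1|.
    have := ler_norm p; have := normr_ge0 a1; have := normr_ge0 g1.
    by case: hp => -[_ [-> _]]; lra.
  have : 0 <= (`|a1| + `|g1| - p) * (x t 0 0 * x t 0 0).
    by apply: mulr_ge0; [rewrite subr_ge0 | rewrite -expr2 sqr_ge0].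
  lra.
- by rewrite x00 mulr0.
Qed.

(** The factor [sg] selects the direction in which [w = b1 x2 - b2 x1] is blocked: in both modes
    [y = sg * w] satisfies [y' <= a4 * y]. *)
Lemma not_controllable_sign (R : realType) (a1 a2 a4 g1 g2 b1 b2 sg : R)
    (S : bimodal_system R) :
  bimodal_A1 S = mat22 a1 0 a2 a4 -> bimodal_A2 S = mat22 g1 0 g2 a4 ->
  bimodal_B S = vec2 b1 b2 -> b1 != 0 -> sg != 0 ->
  0 <= sg * (b1 * a2 + (a4 - a1) * b2) ->
  sg * (b1 * g2 + (a4 - g1) * b2) <= 0 ->
  ~ controllable S.
Proof.
move=> A1 A2 AB b10 sg0 D1 D2 ctr.
(* The target is chosen so that [y T = 1]. *)
have [T [u [x [T0 _ sx x0 xT]]]] := ctr (vec2 0 0) (vec2 0 ((sg * b1)^-1)).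
have [ac1 ac2 dx] := solutionP A1 A2 AB sx.
have [x00 x01] := (vec2P _ _ _).1 x0; have [xT0 xT1] := (vec2P _ _ _).1 xT.
pose y t := sg * (b1 * x t 1 0 - b2 * x t 0 0).
suff : y T <= 0.
  rewrite /y xT0 xT1 mulr0 subr0 mulrA mulfV; last by rewrite mulf_neq0.
  lra.
apply: (@gronwall_le0 R 0 T a4 y (ltW T0)).
- apply: (absolutely_continuous_dominated (C := `|sg| * (`|b1| + `|b2|)) _ ac1 ac2).
  move=> s t _ _ _; rewrite /y.
  have -> : sg * (b1 * x t 1 0 - b2 * x t 0 0) - sg * (b1 * x s 1 0 - b2 * x s 0 0)
    = sg * (b1 * (x t 1 0 - x s 1 0) - b2 * (x t 0 0 - x s 0 0)) by ring.
  rewrite normrM -mulrA ler_wpM2l//.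
  apply: le_trans (ler_normB _ _) _; rewrite !normrM.
  have : 0 <= `|b1| * `|x t 0 0 - x s 0 0| by rewrite mulr_ge0.
  have : 0 <= `|b2| * `|x t 1 0 - x s 1 0| by rewrite mulr_ge0.
  lra.
- apply: negligibleS dx => t; apply: contra_not => dxt tT.
  have [p [q [dx1 dx2 hpq]]] := dxt tT.
  exists (sg * (b1 * (q * x t 0 0 + a4 * x t 1 0 + u t * b2)
                - b2 * (p * x t 0 0 + u t * b1))); last first.
    have h1 := is_deriveZ b1 dx2; have h2 := is_deriveZ b2 dx1.
    exact: (is_deriveZ sg (is_deriveB h1 h2)).
  rewrite -subr_ge0.
  (* The input terms cancel in the derivative of [y]. *)
  rewrite (_ : _ - _ = - (sg * (b1 * q + (a4 - p) * b2) * x t 0 0)); last first.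
    by rewrite /y; ring.
  rewrite oppr_ge0.
  case: hpq => -[hx [-> ->]].
    by rewrite mulr_ge0_le0.
  by rewrite mulr_le0_ge0.
- by rewrite /y x00 x01 !mulr0 subr0 mulr0.
Qed.

(** * Sufficiency: construction of a trajectory *)

Lemma hermite_cubic (R : comNzRingType) (w0 w1 m0 m1 : R) :
  exists w : {poly R}, [/\ w.[0] = w0, w.[1] = w1, w^`().[0] = m0 & w^`().[1] = m1].
Proof.
exists (w0%:P + m0 *: 'X + (3 * (w1 - w0) - 2 * m0 - m1) *: 'X^2 +
        (2 * (w0 - w1) + m0 + m1) *: 'X^3).
by split; rewrite ?(derivD, derivZ, derivC, derivX, derivXn) ?hornerE /=; ring.
Qed.

(** For arguments in different branches, both [|v|] and [|w|] are at most [|v - w|], so the two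
    quotients can be bounded separately. This makes the recovered first coordinate absolutely
    continuous. *)
Lemma piecewise_div_lipschitz (R : realType) (d1 d2 v w : R) : 0 < d1 * d2 ->
  `|(if d1 * v <= 0 then v / d1 else v / d2) -
    (if d1 * w <= 0 then w / d1 else w / d2)|
  <= (`|d1^-1| + `|d2^-1|) * `|v - w|.
Proof.
move=> d12.
have d10 : d1 != 0 by apply: contraTneq d12 => ->; rewrite mul0r ltxx.
have h1 : 0 <= `|d1^-1| * `|v - w| by rewrite mulr_ge0.
have h2 : 0 <= `|d2^-1| * `|v - w| by rewrite mulr_ge0.
have opp x y : d1 * x <= 0 -> 0 < d1 * y -> `|x| <= `|x - y| /\ `|y| <= `|x - y|.
  move=> x0 y0.
  have [d1p|d1n|/eqP] := ltgtP d1 0; last by rewrite (negbTE d10).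
  - move: x0 y0; rewrite nmulr_rle0// nmulr_rgt0// => x0 y0.
    by rewrite (ger0_norm x0) (ltr0_norm y0)
      (ger0_norm (x := x - y)) ?subr_ge0; try split; lra.
  - move: x0 y0; rewrite pmulr_rle0// pmulr_rgt0// => x0 y0.
    by rewrite (ler0_norm x0) (gtr0_norm y0)
      (ler0_norm (x := x - y)) ?subr_le0; try split; lra.
have mixed x y : d1 * x <= 0 -> 0 < d1 * y ->
    `|x / d1 - y / d2| <= (`|d1^-1| + `|d2^-1|) * `|x - y|.
  move=> /opp H /H [hx hy].
  apply: le_trans (ler_normB _ _) _; rewrite !normrM.
  have : `|x| * `|d1^-1| <= `|x - y| * `|d1^-1| by rewrite ler_wpM2r.
  have : `|y| * `|d2^-1| <= `|x - y| * `|d2^-1| by rewrite ler_wpM2r.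
  lra.
case: (leP (d1 * v) 0) => hv; case: (leP (d1 * w) 0) => hw.
- by rewrite -mulrBl normrM; lra.
- exact: mixed.
- by rewrite distrC (distrC v); exact: mixed.
- by rewrite -mulrBl normrM; lra.
Qed.

Lemma absolutely_continuous_vec2 (R : realType) (a b : R) (f g : R -> R) :
  absolutely_continuous_on a b f -> absolutely_continuous_on a b g ->
  absolutely_continuous_on a b (fun t => vec2 (f t) (g t)).
Proof.
apply: (absolutely_continuous_dominated (C := 1)) => s t _ _ _.
rewrite mul1r [leLHS]/Num.Def.normr /= mx_normrE.
apply: bigmax_le; first by rewrite addr_ge0.
move=> [[[|[|]] // ?] j] _; rewrite !mxE /=.
- by rewrite lerDl.
- by rewrite lerDr.
Qed.

Lemma controllable_sufficient (R : realType) (a1 a2 a4 g1 g2 b1 b2 : R)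
    (S : bimodal_system R) :
  bimodal_A1 S = mat22 a1 0 a2 a4 -> bimodal_A2 S = mat22 g1 0 g2 a4 ->
  bimodal_B S = vec2 b1 b2 -> b1 != 0 ->
  0 < (b1 * a2 + (a4 - a1) * b2) * (b1 * g2 + (a4 - g1) * b2) ->
  controllable S.
Proof.
move=> A1 A2 AB b10.
set d1 := _ + _ * b2; set d2 := _ + _ * b2 => d12 x0 xf.
have d10 : d1 != 0 by apply: contraTneq d12 => ->; rewrite mul0r ltxx.
have d20 : d2 != 0 by apply: contraTneq d12 => ->; rewrite mulr0 ltxx.
(* [phi s] is the value of [w' - a4 w] when the first coordinate is [s]. *)
pose phi s := if s <= 0 then d1 * s else d2 * s.
pose w_ (x : 'cV[R]_2) := b1 * x 1 0 - b2 * x 0 0.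
(* The end slopes are those forced by [w' = a4 w + phi x1], so that [x1] takes the prescribed end
   values. *)
have [w [w0 w1 dw0 dw1]] := hermite_cubic (w_ x0) (w_ xf)
  (a4 * w_ x0 + phi (x0 0 0)) (a4 * w_ xf + phi (xf 0 0)).
pose v := w^`() - a4 *: w.
have vE t : v.[t] = w^`().[t] - a4 * w.[t] by rewrite /v !hornerE.
(* This inverts [phi] at [v]: as [d1] and [d2] have the same sign, [d1 * v <= 0] means [x1 <= 0]. *)
pose x1 t := if d1 * v.[t] <= 0 then v.[t] / d1 else v.[t] / d2.
pose x2 t := b1^-1 * (w.[t] + b2 * x1 t).
(* The input is solved from the first equation, [u = (x1' - p x1) / b1], with [x1 = v / d1] or
   [x1 = v / d2]. *)
pose p1 := (b1 * d1)^-1 *: (v^`() - a1 *: v).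
pose p2 := (b1 * d2)^-1 *: (v^`() - g1 *: v).
pose u t := if d1 * v.[t] <= 0 then p1.[t] else p2.[t].
have phiK s : (if d1 * phi s <= 0 then phi s / d1 else phi s / d2) = s.
  rewrite /phi; have [s0|s0] := leP s 0.
    have -> : d1 * (d1 * s) <= 0 by rewrite mulrA pmulr_rle0// -expr2 exprn_even_gt0.
    by field.
  have -> : d1 * (d2 * s) <= 0 = false.
    by apply/negbTE; rewrite -ltNge mulrA mulr_gt0.
  by field.
have dpoly (p : {poly R}) (t : R) : is_derive t 1 (fun s => p.[s]) (p^`().[t]).
  exact: is_derive_poly.
have pE (c a : R) (p q : {poly R}) (t : R) :
    (c *: (p - a *: q)).[t] = c * (p.[t] - a * q.[t]).
  by rewrite hornerZ hornerD hornerN hornerZ.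
have cpoly (p : {poly R}) : continuous (fun s => p.[s]).
  exact: continuous_horner.
have acpoly (p : {poly R}) : absolutely_continuous_on 0 1 (fun s => p.[s]).
  by apply: absolutely_continuous_C1 (dpoly p) _; exact: cpoly.
exists 1, u, (fun t => vec2 (x1 t) (x2 t)); split => //.
- apply: (@locally_integrable_on_dominated _ _ u (fun t => `|p1.[t]| + `|p2.[t]|)).
  + apply: measurable_fun_ifT.
    * apply: measurable_fun_ler => //.
      apply: continuous_measurable_fun => t.
      by apply: cvgM; [exact: cvg_cst | exact: cpoly].
    * by apply: continuous_measurable_fun; exact: cpoly.
    * by apply: continuous_measurable_fun; exact: cpoly.
  + by move=> t; apply: cvgD; apply: cvg_norm; exact: cpoly.
  + by move=> t; rewrite /u; case: ifP => _; rewrite ?lerDl ?lerDr.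
- have acx1 : absolutely_continuous_on 0 1 x1.
    have acv := acpoly v.
    apply: (absolutely_continuous_dominated (C := `|d1^-1| + `|d2^-1|) _ acv acv).
    move=> s t _ _ _; apply: le_trans (piecewise_div_lipschitz _ _ d12) _.
    by apply: ler_wpM2l; rewrite ?addr_ge0// lerDl.
  have acx2 : absolutely_continuous_on 0 1 x2.
    apply: (absolutely_continuous_dominated
      (C := `|b1^-1| * (1 + `|b2|)) _ (acpoly w) acx1) => s t _ _ _.
    rewrite /x2 -mulrBr normrM -mulrA ler_wpM2l//.
    have -> : w.[t] + b2 * x1 t - (w.[s] + b2 * x1 s) =
      (w.[t] - w.[s]) + b2 * (x1 t - x1 s) by ring.
    apply: le_trans (ler_normD _ _) _; rewrite normrM.
    have : 0 <= `|b2| * `|w.[t] - w.[s]| by rewrite mulr_ge0.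
    have : 0 <= `|x1 t - x1 s| by [].
    lra.
  split; first exact: absolutely_continuous_vec2.
  (* In either mode, the second equation follows from the first and from [w' = v + a4 w]. *)
  have dx (t dx1 p q : R) : is_derive t 1 x1 dx1 -> dx1 = p * x1 t + u t * b1 ->
      v.[t] = (b1 * q + (a4 - p) * b2) * x1 t ->
      is_derive t 1 (fun t => vec2 (x1 t) (x2 t))
        (mat22 p 0 q a4 *m vec2 (x1 t) (x2 t) + u t *: vec2 b1 b2).
    move=> dx1t dx1E vt.
    have dx2 : is_derive t 1 x2 (b1^-1 * (w^`().[t] + b2 * dx1)).
      exact: (is_deriveZ b1^-1 (is_deriveD (dpoly w t) (is_deriveZ b2 dx1t))).
    apply/is_derive_affine.
    have E1 : (fun s => vec2 (x1 s) (x2 s) 0 0) = x1.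
      by apply/funext => s; rewrite mxE.
    have E2 : (fun s => vec2 (x1 s) (x2 s) 1 0) = x2.
      by apply/funext => s; rewrite mxE.
    rewrite E1 E2 !mxE /= -dx1E; split=> //.
    apply: is_derive_eq dx2 _.
    have -> : w^`().[t] = v.[t] + a4 * w.[t] by rewrite vE subrK.
    by rewrite vt dx1E /x2; field.
  (* If [v = 0], its roots are not negligible, but [x1] and [u] vanish identically and both modes
     hold at every time. *)
  have [v0|v0] := eqVneq v 0.
    have x10 s : x1 s = 0 by rewrite /x1 v0 horner0 !mul0r if_same.
    have u0 s : u s = 0.
      by rewrite /u /p1 /p2 v0 deriv0 !scaler0 subr0 !scaler0 horner0 if_same.
    have dx10 (t : R) : is_derive t 1 x1 0.
      by rewrite (_ : x1 = cst 0); [exact: is_derive_cst | exact/funext].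
    apply: aeW => t _; rewrite A1 A2 AB.
    by split=> _; apply: (dx t 0); rewrite ?x10 ?u0 ?v0 ?horner0 ?mulr0 ?mul0r ?addr0.
  have vneg : (@lebesgue_measure R).-negligible [set t | root v t].
    have vc : countable [set t | root v t].
      exact: finite_set_countable (finite_roots v0).
    apply/negligibleP; first exact: countable_measurable.
    exact: countable_lebesgue_measure0.
  apply: negligibleS vneg => t; apply: contra_notP => /= /negP vt _.
  have {}vt : v.[t] != 0 by [].
  rewrite bimodal_CE mxE /= A1 A2 AB.
  (* Away from the roots of [v], the sign of [d1 * v] is locally constant, so [x1] coincides near
     [t] with a single branch. *)
  have cdv : {for t, continuous (fun s => d1 * v.[s])}.
    by apply: cvgM; [exact: cvg_cst | exact: cpoly].
  have [dv0|dv0|/eqP] := ltgtP (d1 * v.[t]) 0; last first.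
    by rewrite mulf_eq0 (negbTE d10) (negbTE vt).
  - have x1t : x1 t = v.[t] / d2 by rewrite /x1 leNgt dv0.
    have x1_gt0 : 0 < x1 t.
      rewrite x1t (_ : _ / _ = (d1 * v.[t]) / (d1 * d2)) ?divr_gt0//.
      by field; rewrite d10 d20.
    split; first by rewrite leNgt x1_gt0.
    move=> _; apply: (dx t (v^`().[t] / d2)).
    + have h : is_derive t 1 (fun s => v.[s] / d2) (v^`().[t] / d2).
        have := is_deriveZ d2^-1 (dpoly v t).
        rewrite [_ *: _]mulrC; congr (is_derive _ _ _ _).
        by apply/funext => s; exact: mulrC.
      apply: near_eq_is_derive h.
      near=> s; rewrite /x1 leNgt.
      have -> : 0 < d1 * v.[s] by near: s; exact: cvgr_gt cdv _ dv0.
      by [].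
    + by rewrite x1t /u leNgt dv0 /= /p2 pE; field; rewrite ?b10 ?d10 ?d20.
    + by rewrite x1t -/d2; field.
  - have x1t : x1 t = v.[t] / d1 by rewrite /x1 ltW.
    have x1_lt0 : x1 t < 0.
      rewrite x1t (_ : _ / _ = (d1 * v.[t]) / (d1 * d1)); last by field.
      by rewrite pmulr_llt0// invr_gt0 -expr2 exprn_even_gt0.
    split; last by rewrite leNgt x1_lt0.
    move=> _; apply: (dx t (v^`().[t] / d1)).
    + have h : is_derive t 1 (fun s => v.[s] / d1) (v^`().[t] / d1).
        have := is_deriveZ d1^-1 (dpoly v t).
        rewrite [_ *: _]mulrC; congr (is_derive _ _ _ _).
        by apply/funext => s; exact: mulrC.
      apply: near_eq_is_derive h.
      near=> s; rewrite /x1.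
      have -> : d1 * v.[s] <= 0 by apply: ltW; near: s; exact: cvgr_lt cdv _ dv0.
      by [].
    + by rewrite x1t /u ltW //= /p1 pE; field; rewrite ?b10 ?d10 ?d20.
    + by rewrite x1t -/d1; field.
- have h : x1 0 = x0 0 0.
    rewrite -[RHS]phiK /x1.
    by rewrite vE w0 dw0 [a4 * _ + _]addrC addrK.
  by symmetry; apply/vec2P; rewrite /x2 h w0 /w_; split=> //; field.
- have h : x1 1 = xf 0 0.
    rewrite -[RHS]phiK /x1.
    by rewrite vE w1 dw1 [a4 * _ + _]addrC addrK.
  by symmetry; apply/vec2P; rewrite /x2 h w1 /w_; split=> //; field.
Unshelve. all: by end_near. Qed.

Theorem corollary10 (R : realType) (a1 a2 a4 g1 g2 b1 b2 : R)
    (S : bimodal_system R)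
    (hA1 : bimodal_A1 S = mat22 a1 0 a2 a4)
    (hA2 : bimodal_A2 S = mat22 g1 0 g2 a4)
    (hB : bimodal_B S = vec2 b1 b2)
    (hS : unobservable S) :
  let Delta1 := b1 * a2 + (a4 - a1) * b2 in
  let Delta2 := b1 * g2 + (a4 - g1) * b2 in
  controllable S <-> b1 != 0 /\ 0 < Delta1 * Delta2.
Proof.
move=> Delta1 Delta2; split=> [ctr|[b10 d12]]; last first.
  exact: (controllable_sufficient hA1 hA2 hB b10 d12).
have b10 := controllable_b1_neq0 hA1 hA2 hB ctr; split=> //.
have nctr sg := not_controllable_sign (sg := sg) hA1 hA2 hB b10.
rewrite ltNge; apply/negP => d12.
(* A nonpositive product leaves two sign patterns, excluded by [sg = 1] and [sg = -1]. *)
have [/andP[d1 d2]|ndd] := boolP ((0 <= Delta1) && (Delta2 <= 0)).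
  by apply: (nctr 1 (oner_neq0 _)) ctr; rewrite mul1r.
have [d1 d2] : Delta1 <= 0 /\ 0 <= Delta2.
  move: ndd d12; have [d1|d1] := leP 0 Delta1; have [d2|d2] := leP Delta2 0 => //= _.
  - by rewrite pmulr_lle0// => d10; split=> //; exact: ltW.
  - by rewrite nmulr_rle0// => d20; split=> //; exact: ltW.
  - by move=> _; split; exact: ltW.
by apply: (nctr (-1)) ctr; rewrite ?oppr_eq0 ?oner_neq0// mulN1r ?oppr_ge0 ?oppr_le0.
Qed.
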